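(* Let $X$ be a complete lattice with top element $1$ and let $a\in X$. Let $K_X$ be the set of compact elements of $X$ and let $$\mathrm{Alg}_a(X):=\Big\{a\vee\bigvee\Sigma\ \Big|\ \Sigma\subseteq K_X\Big\}.$$ Then the following statements hold. \begin{enumerate} \item $\mathrm{Alg}_a(X)$ is the smallest subset of the interval $[a,1]$ that contains every element $a\vee c$, with $c\in K_X$, and is closed under arbitrary non-empty suprema computed in $X$. \item The inclusion $i:\mathrm{Alg}_a(X)\to[a,1]$ admits a right adjoint $$\rho_a:[a,1]\to\mathrm{Alg}_a(X),\qquad \rho_a(x):=a\vee\bigvee\{c\in K_X\mid c\le x\}.$$ Equivalently, for $y\in\mathrm{Alg}_a(X)$ and $x\in[a,1]$, $$i(y)\le x\iff y\le\rho_a(x).$$ Thus $\rho_a(x)$ is the largest element of $\mathrm{Alg}_a(X)$ below $x$. \item $\mathrm{Alg}_a(X)$ is an algebraic lattice. Arbitrary non-empty suprema in $\mathrm{Alg}_a(X)$ are computed as in $X$, while for every family $(x_j)_j$ in $\mathrm{Alg}_a(X)$ $$\bigwedge_{\mathrm{Alg}_a(X)}x_j=\rho_a\Big(\bigwedge_X x_j\Big).$$ The compact elements of $\mathrm{Alg}_a(X)$ are precisely the elements of the form $a\vee c$, with $c\in K_X$. \end{enumerate}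
   Context: An element $c$ of a poset $P$ is compact if, for every (nonempty) directed subset $\Delta\subseteq P$ whose supremum exists, $c\le\bigvee\Delta$ implies $c\le d$ for some $d\in\Delta$; $K_P$ denotes the set of compact elements of $P$. A complete lattice $L$ is algebraic if every $x\in L$ satisfies $x=\bigvee\{c\in K_L\mid c\le x\}$. The interval is $[a,1]=\{x\in X\mid a\le x\le 1\}$. The set $\mathrm{Alg}_a(X)$, called the algebraic core of $X$ over $a$, carries the order induced from $X$; $\Sigma=\varnothing$ is allowed in its definition. The symbols $\bigwedge_{\mathrm{Alg}_a(X)}$ and $\bigwedge_X$ denote infima computed in $\mathrm{Alg}_a(X)$ and in $X$ respectively. *)

(* Defs.v *)
From HB Require Import structures.
From mathcomp Require Import all_boot all_order.
From mathcomp Require Import boolp classical_sets.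

Set Implicit Arguments.
Unset Strict Implicit.
Unset Printing Implicit Defensive.

Import Order.TTheory.

Local Open Scope classical_set_scope.
Local Open Scope order_scope.

Section PosetNotions.
Context {d : Order.disp_t} {P : porderType d}.

Definition directed (D : set P) : Prop :=
  D !=set0 /\
  forall x y, D x -> D y -> exists z, [/\ D z, x <= z & y <= z].

(* The quantification over [s] with [supremums D s] restricts the condition to
   the directed sets whose supremum exists. *)
Definition compact_elt (c : P) : Prop :=
  forall (D : set P) (s : P), directed D -> supremums D s -> c <= s ->
    exists2 x, D x & c <= x.

Definition compact_elts : set P := [set c | compact_elt c].

Definition is_greatest (E : set P) (m : P) : Prop := E m /\ ubound E m.

End PosetNotions.

Definition complete_lattice {d} (P : porderType d) : Prop :=
  forall A : set P, supremums A !=set0 /\ infimums A !=set0.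

Definition algebraic_lattice {d} (P : porderType d) : Prop :=
  complete_lattice P /\
  forall x : P, supremums [set c | compact_elts c /\ c <= x] x.

Definition right_adjoint {d d'} {P : porderType d} {Q : porderType d'}
    (f : P -> Q) (g : Q -> P) : Prop :=
  [/\ {homo f : x y / x <= y}, {homo g : x y / x <= y} &
      forall x y, f x <= y <-> x <= g y].

Definition is_smallest_set {T : Type} (C : set (set T)) (A : set T) : Prop :=
  C A /\ forall B, C B -> A `<=` B.

(* The classical set [A] as a poset, with the order induced from [T]. *)
Definition subposet {d} {T : porderType d} (A : set T) : Type := set_type A.

HB.instance Definition _ d (T : porderType d) (A : set T) :=
  SubType.on (subposet A).
HB.instance Definition _ d (T : porderType d) (A : set T) :=
  Choice.on (subposet A).
HB.instance Definition _ d (T : porderType d) (A : set T) :=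
  [SubChoice_isSubPOrder of subposet A by <: with d].

Section AlgebraicCore.
Context {d : Order.disp_t} {X : tbLatticeType d}.
Implicit Types (a : X) (S : set X).

(* In a complete lattice the default values [\bot] and [\top] are only used
   for [set0], where they are the actual supremum and infimum. *)
Definition bigjoin S : X := supremum \bot S.
Definition bigmeet S : X := infimum \top S.

Definition upper_itv a : set X := [set x | a <= x <= \top].

Definition Alg a : set X :=
  [set a `|` bigjoin S | S in [set S | S `<=` compact_elts]].

Lemma Alg_sub_upper_itv a : Alg a `<=` upper_itv a.
Proof. by move=> _ [S _ <-]; rewrite /upper_itv /= leUl lex1. Qed.

Definition Alg_incl a (y : subposet (Alg a)) : subposet (upper_itv a) :=
  exist _ (val y) (mem_set (Alg_sub_upper_itv (set_mem (valP y)))).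

Lemma rho_in_Alg a (x : X) :
  Alg a (a `|` bigjoin [set c | compact_elts c /\ c <= x]).
Proof. by exists [set c | compact_elts c /\ c <= x] => // c []. Qed.

Definition rho a (x : subposet (upper_itv a)) : subposet (Alg a) :=
  exist _ (a `|` bigjoin [set c | compact_elts c /\ c <= val x])
        (mem_set (rho_in_Alg a (val x))).

End AlgebraicCore.

(* Main.v *)
Require Import Defs.
From mathcomp Require Import all_boot all_order.
From mathcomp Require Import boolp classical_sets.
Local Open Scope classical_set_scope.
Local Open Scope order_scope.

Import Order.TTheory.

(** Everything rests on a test for inequalities out of the core: if [y] lies in
    [Alg a], then [y <= z] as soon as [a <= z] and every compact element below
    [y] is below [z] ([Alg_le]); conversely this property, together with
    [a <= y], characterises membership ([AlgI]).  In other words [y] is the join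
    of the elements [a `|` c], with [c <= y] compact.

    The adjunction is then immediate: if [y <= x] with [y] in the core, the
    compact elements below [y] are below [x], so [y <= rho x].  Non-empty joins
    stay in the core because a compact element below a member of [S] is below
    the join of [S]; hence joins are those of [X], and meets are obtained by
    applying the right adjoint to the meets of [X].

    An element [a `|` c] is compact in the core because directed suprema there
    are those of [X], and because [a] lies below every element of the core.
    For the converse, [\bot] is compact and compact elements are stable under
    binary joins, so that the elements [a `|` c] with [c <= k] compact form a
    directed set ([directed_cjoin]), whose supremum is [k] when [k] is in the
    core; a compact [k] is then below one of them, hence equal to it. *)

(** * Compact elements and joins in a complete lattice *)

Section CompleteLattice.
Set Implicit Arguments.
Unset Strict Implicit.
Unset Printing Implicit Defensive.
Context {d : Order.disp_t} {X : tbLatticeType d}.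

(** Directed sets are non-empty, which is what makes the bottom compact. *)
Lemma compact_bot : compact_elt (\bot : X).
Proof. by move=> D s [[x Dx] _] _ _; exists x; rewrite ?le0x. Qed.

Lemma compact_join (b c : X) :
  compact_elt b -> compact_elt c -> compact_elt (b `|` c).
Proof.
move=> kb kc D s dD Ds; rewrite leUx => /andP[bs cs].
have [x Dx bx] := kb _ _ dD Ds bs; have [y Dy cy] := kc _ _ dD Ds cs.
have [z [Dz xz yz]] := dD.2 _ _ Dx Dy.
by exists z; rewrite // leUx (le_trans bx xz) (le_trans cy yz).
Qed.

Context (hX : complete_lattice X).

Lemma bigjoinP (S : set X) : supremums S (bigjoin S).
Proof.
rewrite /bigjoin /supremum; case: ifPn => [/eqP->|_]; last first.
  by apply: xgetPex; exact: (hX S).1.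
by split=> [x []|x _]; rewrite ?le0x.
Qed.

Lemma bigmeetP (S : set X) : infimums S (bigmeet S).
Proof.
rewrite /bigmeet /infimum; case: ifPn => [/eqP->|_]; last first.
  by apply: xgetPex; exact: (hX S).2.
by split=> [x []|x _]; rewrite ?lex1.
Qed.

Lemma le_bigjoin (S : set X) x : S x -> x <= bigjoin S.
Proof. exact: (bigjoinP S).1. Qed.

Lemma bigjoin_le (S : set X) z : ubound S z -> bigjoin S <= z.
Proof. exact: (bigjoinP S).2. Qed.

(** * Membership in the algebraic core *)

Variable a : X.

Lemma le_Alg y : Alg a y -> a <= y.
Proof. by case=> S _ <-; exact: leUl. Qed.

(** A set of compact elements generating [y] lies below [y], so testing all the
    compact elements below [y] is enough. *)
Lemma Alg_le y z : Alg a y -> a <= z ->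
  (forall c, compact_elt c -> c <= y -> c <= z) -> y <= z.
Proof.
case=> S kS <- az h; rewrite leUx az; apply: bigjoin_le => c Sc.
by apply: h; [exact: kS | rewrite lexU2 // le_bigjoin ?orbT].
Qed.

(** With [le_core], this makes the join underlying [rho x] the largest element of
    the core below [x]; both are stated in [X], where no packaging of elements
    into a subposet interferes. *)
Lemma core_le x : a <= x ->
  a `|` bigjoin [set c | compact_elts c /\ c <= x] <= x.
Proof. by move=> ax; rewrite leUx ax; apply: bigjoin_le => c []. Qed.

Lemma le_core x y : Alg a y -> y <= x ->
  y <= a `|` bigjoin [set c | compact_elts c /\ c <= x].
Proof.
move=> Ay yx; apply: Alg_le => // [|c kc cy]; first exact: leUl.
by apply: lexU2; rewrite le_bigjoin ?orbT //; split=> //; exact: le_trans yx.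
Qed.

Lemma AlgI y : a <= y ->
  (forall z, a <= z -> (forall c, compact_elt c -> c <= y -> c <= z) ->
     y <= z) -> Alg a y.
Proof.
move=> ay h; exists [set c | compact_elts c /\ c <= y]; first by move=> c [].
apply: le_anti; rewrite core_le //=; apply: h => [|c kc cy]; first exact: leUl.
by apply: lexU2; rewrite le_bigjoin ?orbT.
Qed.

Lemma Alg_cjoin c : compact_elt c -> Alg a (a `|` c).
Proof.
move=> kc; apply: AlgI => [|z az h]; first exact: leUl.
by rewrite leUx az h ?leUr.
Qed.

Lemma Alg_a : Alg a a.
Proof. by rewrite -[X in Alg a X]joinx0; exact/Alg_cjoin/compact_bot. Qed.

(** Non-emptiness of [S] is used to place the join of [S] above [a]. *)
Lemma Alg_bigjoin (S : set X) : S `<=` Alg a -> S !=set0 -> Alg a (bigjoin S).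
Proof.
move=> SA [s Ss]; apply: AlgI => [|z az h].
  exact: le_trans (le_Alg (SA _ Ss)) (le_bigjoin Ss).
apply: bigjoin_le => x Sx; apply: Alg_le => [|//|c kc cx]; first exact: SA.
by apply: h => //; apply: le_trans cx (le_bigjoin Sx).
Qed.

Lemma Alg_smallest (B : set X) :
  (forall c, compact_elts c -> B (a `|` c)) ->
  (forall S : set X, S `<=` B -> S !=set0 -> B (bigjoin S)) ->
  Alg a `<=` B.
Proof.
move=> Bc BS y Ay.
pose S := [set a `|` c | c in [set c | compact_elts c /\ c <= y]].
have Sy x : S x -> x <= y.
  by move=> [c [_ cy] <-]; rewrite leUx cy le_Alg.
have -> : y = bigjoin S.
  apply: le_anti; rewrite andbC bigjoin_le //=.
  (* The element [a = a `|` \bot] of [S] puts the join of [S] above [a]. *)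
  apply: Alg_le => // [|c kc cy].
    apply: le_bigjoin; exists \bot; last exact: joinx0.
    by split; [exact: compact_bot | exact: le0x].
  by apply: le_trans (leUr c a) (le_bigjoin _); exists c.
apply: BS; first by move=> _ [c [kc _] <-]; exact: Bc.
exists (a `|` \bot); exists \bot => //.
by split; [exact: compact_bot | exact: le0x].
Qed.

(** * The algebraic core as a poset *)

Local Notation A := (subposet (Alg a)).

Lemma valA (y : A) : Alg a (val y).
Proof. exact: set_mem (valP y). Qed.

Definition toA y (Ay : Alg a y) : A := exist _ y (mem_set Ay).

Definition to_itv x (ux : upper_itv a x) : subposet (upper_itv a) :=
  exist _ x (mem_set ux).

Lemma rho_adj (y : A) (x : subposet (upper_itv a)) :
  Alg_incl y <= x <-> y <= rho x.
Proof.
have /andP[ax _] := set_mem (valP x).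
split=> [yx|yx]; first exact: (le_core (valA y)).
exact: le_trans (yx : val y <= val (rho x)) (core_le ax).
Qed.

Lemma Alg_incl_homo : {homo @Alg_incl d X a : x y / x <= y}.
Proof. by []. Qed.

Lemma rho_homo : {homo @rho d X a : x y / x <= y}.
Proof.
by move=> x y xy; apply/rho_adj; apply: le_trans xy; apply/rho_adj.
Qed.

Lemma leEval (x y : A) : (x <= y) = (val x <= val y).
Proof. by []. Qed.

Lemma supremums_val (S : set A) (s : A) :
  supremums (val @` S) (val s) -> supremums S s.
Proof.
case=> [us ls]; split=> [x Sx|z uz]; first by apply: us; exists x.
by apply: ls => _ [x Sx <-]; exact: uz.
Qed.

Lemma supremums_Alg (S : set A) : S !=set0 ->
  exists2 s, supremums S s & val s = bigjoin (val @` S).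
Proof.
move=> [s Ss].
have AS : Alg a (bigjoin (val @` S)).
  apply: Alg_bigjoin; first by move=> _ [x _ <-]; exact: valA.
  by exists (val s); exists s.
by exists (toA AS) => //; apply/supremums_val/bigjoinP.
Qed.

(** A right adjoint preserves infima, and [rho] fixes the elements of the core;
    the empty family is covered since its meet in [X] is [\top]. *)
Lemma infimums_Alg (S : set A) (m : subposet (upper_itv a)) :
  infimums (val @` S) (val m) -> infimums S (rho m).
Proof.
case=> [lm um]; split=> [x Sx|z lz].
  have mx : val m <= val x by apply: lm; exists x.
  by apply: le_trans (core_le _) mx; have /andP[] := set_mem (valP m).
apply/rho_adj; apply: um => _ [x Sx <-]; exact: lz.
Qed.

Lemma upper_itv_bigmeet (S : set A) : upper_itv a (bigmeet (val @` S)).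
Proof.
apply/andP; split; last exact: lex1.
by apply: (bigmeetP _).2 => _ [x _ <-]; exact/le_Alg/valA.
Qed.

Lemma complete_Alg : complete_lattice A.
Proof.
move=> S; split; last first.
  exists (rho (to_itv (upper_itv_bigmeet S))).
  by apply: infimums_Alg; exact: bigmeetP.
have [->|/set0P /supremums_Alg[s Ss _]] := eqVneq S set0; last by exists s.
by exists (toA Alg_a); split=> [x []|z _]; exact/le_Alg/valA.
Qed.

(** * Compact elements of the algebraic core *)

(** Suprema in the core agree with those in [X] on non-empty sets, so a directed
    set of the core covering [a `|` c] covers [c] in [X]. *)
Lemma compact_cjoin (k : A) c : compact_elt c -> val k = a `|` c ->
  compact_elt k.
Proof.
move=> kc ek D s [D0 dD] Ds ks.
have [s' Ds' es] := supremums_Alg D0.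
have {Ds'} ss' := is_subset1_supremums Ds Ds'; subst s'.
have cs : c <= bigjoin (val @` D).
  by rewrite -es; apply: le_trans (leUr c a) _; rewrite -ek.
have [|_ [x Dx <-] cx] := kc (val @` D) _ _ (bigjoinP _) cs.
  split; first by have [x Dx] := D0; exists (val x); exists x.
  move=> _ _ [x Dx <-] [y Dy <-]; have [z [Dz xz yz]] := dD _ _ Dx Dy.
  by exists (val z); split=> //; exists z.
by exists x; rewrite // leEval ek leUx cx (le_Alg (valA x)).
Qed.

Definition cjoins (k : A) : set A :=
  [set y : A | exists2 c, compact_elt c /\ c <= val k & val y = a `|` c].

Lemma directed_cjoins k : directed (cjoins k).
Proof.
split.
  exists (toA Alg_a); exists \bot; rewrite /= ?joinx0 //.
  by split; [exact: compact_bot | exact: le0x].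
move=> x y [b [kb bk] ex] [c [kc ck] ey].
have kbc := compact_join kb kc.
exists (toA (Alg_cjoin kbc)); split.
- by exists (b `|` c) => //; rewrite leUx bk.
- by rewrite leEval ex /= joinA leUl.
- by rewrite leEval ey /= leU2 ?leUr.
Qed.

Lemma supremums_cjoins k : supremums (cjoins k) k.
Proof.
split=> [y [c [kc ck] ey]|z uz].
  by rewrite leEval ey leUx ck (le_Alg (valA k)).
apply: Alg_le (valA k) (le_Alg (valA z)) _ => c kc ck.
have /uz : cjoins k (toA (Alg_cjoin kc)) by exists c.
by rewrite leEval; apply: le_trans; exact: leUr.
Qed.

Lemma compact_AlgP (k : A) :
  compact_elt k <-> exists2 c, compact_elt c & a `|` c = val k.
Proof.
split=> [kk|[c kc ek]]; last by apply: (compact_cjoin kc).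
have [y Dy ky] := kk _ _ (directed_cjoins k) (supremums_cjoins k) (lexx k).
have yk := (supremums_cjoins k).1 y Dy.
have -> : k = y by apply: le_anti; rewrite ky.
by have [c [kc _] ey] := Dy; exists c.
Qed.

Lemma algebraic_Alg : algebraic_lattice A.
Proof.
split=> [|x]; first exact: complete_Alg.
split=> [c []//|z uz]; apply: (supremums_cjoins x).2 => y xy; apply: uz; split.
  by have [c [kc _] ey] := xy; apply: (compact_cjoin kc).
exact: (supremums_cjoins x).1.
Qed.

End CompleteLattice.

Theorem theorem4p1 (d : Order.disp_t) (X : tbLatticeType d)
    (hX : complete_lattice X) (a : X) :
  is_smallest_set
    [set B : set X |
       [/\ B `<=` upper_itv a,
           forall c, compact_elts c -> B (a `|` c) &
           forall S : set X, S `<=` B -> S !=set0 -> B (bigjoin S)]]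
    (Alg a)
  /\
  (right_adjoint (@Alg_incl d X a) (@rho d X a) /\
   (forall (y : subposet (Alg a)) (x : subposet (upper_itv a)),
      Alg_incl y <= x <-> y <= rho x) /\
   (forall x : subposet (upper_itv a),
      is_greatest [set y : subposet (Alg a) | val y <= val x] (rho x)))
  /\
  (algebraic_lattice (subposet (Alg a)) /\
   (forall S : set (subposet (Alg a)), S !=set0 ->
      exists2 s, supremums S s & val s = bigjoin (val @` S)) /\
   (forall (J : Type) (x : J -> subposet (Alg a)),
      exists2 m : subposet (upper_itv a),
        val m = bigmeet (range (fun j => val (x j))) &
        infimums (range x) (rho m)) /\
   val @` @compact_elts d (subposet (Alg a)) =
     [set a `|` c | c in @compact_elts d X]).
Proof.
split; last split.
- split; last by move=> B [_ Bc BS]; exact: Alg_smallest.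
  by split; [exact: Alg_sub_upper_itv | exact: Alg_cjoin | exact: Alg_bigjoin].
- split.
    by split; [exact: Alg_incl_homo | exact: rho_homo | exact: rho_adj].
  split=> [y x|x]; first exact: rho_adj.
  split=> [|y yx]; last exact/(rho_adj hX).
  exact: (rho_adj hX (rho x) x).2 (lexx _).
- split; first exact: algebraic_Alg.
  split; first exact: supremums_Alg.
  split=> [J x|].
    have e : range (fun j => val (x j)) = val @` range x by rewrite image_comp.
    exists (to_itv (upper_itv_bigmeet hX (range x))); rewrite /=.
      by rewrite e.
    by apply: infimums_Alg => //; exact: bigmeetP.
  rewrite eqEsubset; split=> [_ [k /(compact_AlgP hX)[c kc ek] <-]|_ [c kc <-]].
    by exists c.
  exists (toA (Alg_cjoin hX a kc)) => //.
  by apply/(compact_AlgP hX); exists c.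
Qed.
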